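(* Let $n>0$, let $(\sigma_i)_{i\in\mathbb{N}}$ be a nondecreasing sequence with $\sigma_i\ge\sigma>0$, and let $a=(a_i)_{i\in\mathbb{N}}$ be a nonincreasing sequence in $(0,+\infty]$ with $a_i\to0$ as $i\to\infty$. Let $\mathcal{H}=\mathcal{H}(a)=\{\theta\in\ell_2:\ |\theta_i|\le a_i,\ i\in\mathbb{N}\}$. Define $$d_o=\max\Bigl\{k\in\mathbb{N}:\ \sum_{i=1}^{k}\sigma_i\bigl(\sigma_ka_k^{-2}-\sigma_ia_i^{-2}\bigr)\le n\Bigr\}.$$ Then the optimal allocation $\bar n_o=\bar n_o(n)=(n_{o,i})_{i\in\mathbb{N}}$ over $\mathcal{H}$, i.e. an allocation in $\mathcal{N}_n$ satisfying $R(\bar n_o,\mathcal{H})=\inf_{\bar n\in\mathcal{N}_n}R(\bar n,\mathcal{H})$, is given by $$n_{o,i}=\frac{\sigma_i\bigl(n+\sum_{k=1}^{d_o}\sigma_k^2a_k^{-2}\bigr)}{\sum_{k=1}^{d_o}\sigma_k}-\sigma_i^2a_i^{-2},\quad i=1,\ldots,d_o,\qquad n_{o,i}=0\ \text{ for } i>d_o,$$ and the corresponding optimized risk is $$R(\bar n_o,\mathcal{H})=\inf_{\bar n\in\mathcal{N}_n}R(\bar n,\mathcal{H})=\frac{\bigl[\sum_{i=1}^{d_o}\sigma_i\bigr]^2}{n+\sum_{i=1}^{d_o}\sigma_i^2a_i^{-2}}+\sum_{i=d_o+1}^{\infty}a_i^2 .$$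
   Context: Model: one observes independent $X_i\sim N(\theta_i,\sigma_i^2/n_i)$, $i\in\mathbb{N}$, with known $\sigma_i>0$ and unknown $\theta=(\theta_i)_{i\in\mathbb{N}}\in\ell_2$. The vector $\bar n=(n_i)_{i\in\mathbb{N}}$ with real $n_i\ge0$ is called the measurement allocation. For $b>0$, the set of allocations with measurement budget at most $b$ is $$\mathcal{N}_b=\Bigl\{\bar m=(m_i)_{i\in\mathbb{N}}:\ m_i\ge0,\ \sum_{i\in\mathbb{N}}m_i\le b\Bigr\}.$$ Minimax linear risk: for $\Theta\subseteq\ell_2$, $$R(\bar n,\Theta)=\inf_{\lambda}\sup_{\theta\in\Theta}\sum_{i\in\mathbb{N}}\Bigl(\frac{\sigma_i^2\lambda_i^2}{n_i}+(1-\lambda_i)^2\theta_i^2\Bigr),$$ the infimum being over all real sequences $\lambda=(\lambda_i)_{i\in\mathbb{N}}$; this is the minimax quadratic risk $\mathrm{E}_\theta\|\hat\theta(\lambda)-\theta\|^2$ over linear estimators $\hat\theta(\lambda)=(\lambda_iX_i)_{i\in\mathbb{N}}$, with $\|\cdot\|$ the $\ell_2$-norm. Conventions: $0/0=0$; $x/(+\infty)=0$ for $x\in\mathbb{R}$ (so $a_i^{-2}=0$ if $a_i=+\infty$); $x/0=+\infty$ for $x>0$. Risks take values in $[0,+\infty]$. *)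

(* Defs.v *)
From HB Require Import structures.
From mathcomp Require Import all_boot all_order all_algebra.
From mathcomp Require Import all_classical all_reals all_analysis.

Set Implicit Arguments.
Unset Strict Implicit.
Unset Printing Implicit Defensive.

Import Order.TTheory GRing.Theory Num.Theory.
Import numFieldNormedType.Exports.

Local Open Scope classical_set_scope.
Local Open Scope ring_scope.

(* Sequences are indexed from 0: the value at index i stands for the
   coordinate i + 1 of a sequence indexed by {1, 2, ...}. *)

Definition ell2 {R : realType} : set (nat -> R) :=
  [set theta | (\sum_(i <oo) (theta i ^+ 2)%:E < +oo)%E].

Definition allocations {R : realType} (b : R) : set (nat -> R) :=
  [set m | (forall i, 0 <= m i) /\ (\sum_(i <oo) (m i)%:E <= b%:E)%E].

(* Division in \bar R follows the intended conventions:
   0 / 0 = 0 * +oo = 0, and x / 0 = x * +oo = +oo for x > 0. *)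
Definition linear_risk {R : realType} (sigma nbar lambda theta : nat -> R)
    : \bar R :=
  (\sum_(i <oo) ((sigma i ^+ 2 * lambda i ^+ 2)%:E / (nbar i)%:E
                 + ((1 - lambda i) ^+ 2 * theta i ^+ 2)%:E))%E.

Definition minimax_linear_risk {R : realType} (sigma nbar : nat -> R)
    (Theta : set (nat -> R)) : \bar R :=
  ereal_inf [set ereal_sup [set linear_risk sigma nbar lambda theta
                           | theta in Theta]
            | lambda in [set: nat -> R]].

Definition hyperrectangle {R : realType} (a : nat -> \bar R)
    : set (nat -> R) :=
  [set theta | ell2 theta /\ forall i, (`|theta i|%:E <= a i)%E].

(* The number x^{-2}; it is 0 at x = +oo. *)
Definition invsq {R : realType} (x : \bar R) : R := fine ((x ^+ 2)^-1)%E.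

(* k counts coordinates, so that the k-th one has index k.-1. *)
Definition active_counts {R : realType} (sigma : nat -> R) (a : nat -> \bar R)
    (n : R) : set nat :=
  [set k | (1 <= k)%N /\
    \sum_(i < k) sigma i * (sigma k.-1 * invsq (a k.-1)
                            - sigma i * invsq (a i)) <= n].

Definition is_max (A : set nat) (d : nat) : Prop :=
  A d /\ forall k, A k -> (k <= d)%N.

Definition opt_alloc {R : realType} (sigma : nat -> R) (a : nat -> \bar R)
    (n : R) (d : nat) : nat -> R :=
  fun i => if (i < d)%N then
      sigma i * (n + \sum_(k < d) sigma k ^+ 2 * invsq (a k))
        / (\sum_(k < d) sigma k)
      - sigma i ^+ 2 * invsq (a i)
    else 0.

(* Main.v *)
Require Import Defs.
From HB Require Import structures.
From mathcomp Require Import all_boot all_order all_algebra.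
From mathcomp Require Import all_classical all_reals all_analysis.
From mathcomp Require Import ring lra.

Set Implicit Arguments.
Unset Strict Implicit.
Unset Printing Implicit Defensive.

Import Order.TTheory GRing.Theory Num.Theory.
Import numFieldNormedType.Exports.

Local Open Scope classical_set_scope.
Local Open Scope ring_scope.

(** For fixed allocation [m] and weights [l], the adversary maximizes the risk
    coordinate by coordinate, so the worst risk over the hyperrectangle is the
    series of the terms s^2 l^2 / m + (1 - l)^2 a^2; that it is no smaller is
    [sum_worst_term_le].  What remains is to share the budget between separate
    coordinates: minimizing over l gives s^2 / (m + s^2 a^-2), a convex
    decreasing function of m, and the solution is water-filling.

    Put w = s a^-2 (the [level] of a coordinate, nondecreasing in its index).
    The marginal gain s^2 / (m + s^2 a^-2)^2 equals 1 / p^2 exactly when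
    m = s (p - w); hence there is a common level c, the [water_level], such that
    coordinates with w <= c receive s (c - w) and the others nothing.  The
    coordinates below the water level are the first d, d being the largest
    active count, and c is fixed by exhausting the budget.

    Optimality is Lagrangian duality with price 1 / c^2 for a measurement.  The
    elementary inequality [worst_term_ge] bounds a worst term from below by an
    affine function of m of slope - 1 / p^2, for any p > 0, whatever l is; it
    comes from two completed squares.  Taking p = c for the coordinates below
    the water level and p = w for the others gives [opt_term_le], term by term,
    and summing yields the lower bound [minimax_risk_ge].  The bound is attained
    by [opt_alloc] with the weights l = 1 - w / c below the water level and
    l = 0 above it ([minimax_risk_opt_alloc_le]), for which the squares vanish. *)

(** * Inverse squares of extended reals *)

Lemma invsqy (R : realType) : invsq (+oo%E : \bar R) = 0.
Proof. by rewrite /invsq expe2 mulyy invey. Qed.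

Lemma invsq_fin (R : realType) (r : R) : invsq r%:E = (r ^+ 2)^-1.
Proof. by rewrite /invsq -EFin_expe fine_invr. Qed.

Lemma invsq_ge0 (R : realType) (x : \bar R) : (0 < x)%E -> 0 <= invsq x.
Proof.
case: x => [r||] // _.
by rewrite invsq_fin invr_ge0 sqr_ge0.
Qed.

Lemma invsq_nincr (R : realType) (x y : \bar R) :
  (0 < x)%E -> (x <= y)%E -> invsq y <= invsq x.
Proof.
move=> x0.
case: y => [s||] xy; last by move: xy x0; rewrite leeNy_eq => /eqP ->.
  case: x x0 xy => [r||] //; rewrite lte_fin lee_fin => r0 rs.
  have s0 : 0 < s by exact: lt_le_trans rs.
  by rewrite !invsq_fin lef_pV2 ?posrE ?exprn_gt0// lerXn2r ?nnegrE// ltW.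
by rewrite invsqy invsq_ge0.
Qed.

Lemma sqr_gt0_invsq (R : realType) (x : \bar R) :
  (0 < x)%E -> 0 < invsq x -> (x ^+ 2 = ((invsq x)^-1)%:E)%E.
Proof.
case: x => [r||] //; last by rewrite invsqy ltxx.
by rewrite invsq_fin invrK EFin_expe.
Qed.

Lemma invsq_cvgy (R : realType) (a : nat -> \bar R) (M : R) :
  (forall i, (0 < a i)%E) -> a @ \oo --> 0%E ->
  exists k0, forall k, (k0 <= k)%N -> M < invsq (a k).
Proof.
move=> a_gt0 a_cvg0.
pose e := (`|M| + 1)^-1.
have M1 : 0 < `|M| + 1 by rewrite ltr_wpDl.
have e0 : 0 < e by rewrite invr_gt0.
have e1 : e <= 1 by rewrite invf_le1// lerDr.
have [k0 _ k0P] : \forall k \near \oo, (a k < e%:E)%E.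
  exact: (a_cvg0 _ (nbhs_open_ereal_lt (f := fun=> e) e0)).
exists k0 => k /k0P /=.
have := a_gt0 k; case: (a k) => [r||] //; rewrite !lte_fin => r0 re.
rewrite invsq_fin.
have : `|M| + 1 < r^-1 by rewrite -[ltLHS]invrK ltf_pV2 ?posrE.
have : r^-1 <= (r ^+ 2)^-1.
  rewrite lef_pV2 ?posrE ?exprn_gt0// expr2 ger_pMr//.
  by apply: le_trans (ltW re) _.
by have := ler_norm M; lra.
Qed.

(** * Worst case over the hyperrectangle *)

(** The supremum of the summand of the linear risk when the parameter ranges
    over the reals of absolute value at most x.  At x = +oo it is
    infinite unless l = 1, where the bias vanishes because 0 * +oo = 0. *)
Definition worst_term {R : realType} (s m l : R) (x : \bar R) : \bar R :=
  ((s ^+ 2 * l ^+ 2)%:E / m%:E + ((1 - l) ^+ 2)%:E * x ^+ 2)%E.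

Lemma variance_term_ge0 (R : realType) (s m l : R) : 0 <= m ->
  (0 <= (s ^+ 2 * l ^+ 2)%:E / m%:E)%E.
Proof.
move=> m0; apply: mule_ge0; first by rewrite lee_fin mulr_ge0 ?sqr_ge0.
by rewrite inve_ge0 lee_fin.
Qed.

Lemma worst_term_ge0 (R : realType) (s m l : R) (x : \bar R) : 0 <= m ->
  (0 < x)%E -> (0 <= worst_term s m l x)%E.
Proof.
move=> m0 x0; rewrite adde_ge0 ?variance_term_ge0//.
by rewrite mule_ge0// ?lee_fin ?sqr_ge0// expe_ge0// ltW.
Qed.

(** With m > 0 and x = r finite, the difference of the two sides is
    (s l - m / p)^2 / m + ((1 - l) r - s / (r p))^2.  The cross terms
    2 s l / p and 2 s (1 - l) / p add up to 2 s / p, so that the bound does not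
    depend on l: it is the tangent line, as a function of m, to the risk of
    the best weight at m = s (p - s r^-2). *)
Lemma worst_term_ge (R : realType) (s m l p : R) (x : \bar R) :
  0 < s -> 0 <= m -> 0 < p -> (0 < x)%E ->
  ((2 * s / p - s ^+ 2 * invsq x / p ^+ 2 - m / p ^+ 2)%:E
     <= worst_term s m l x)%E.
Proof.
move=> s0 m0 p0 x0.
(* At m = 0 the variance is 0 when l = 0, and infinite otherwise. *)
have variance_ge : ((2 * s * l / p - m / p ^+ 2)%:E
    <= (s ^+ 2 * l ^+ 2)%:E / m%:E)%E.
  rewrite inver; case: (eqVneq m 0) => [->|m_neq0].
    have [->|l0] := eqVneq l 0.
      by rewrite !(mulr0, mul0r) expr0n mulr0 mul0e subr0.
    by rewrite gt0_muley ?leey// lte_fin mulr_gt0 ?exprn_even_gt0// lt0r_neq0.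
  have {m_neq0}m_gt0 : 0 < m by rewrite lt0r m_neq0.
  rewrite -EFinM lee_fin -subr_ge0.
  have -> : s ^+ 2 * l ^+ 2 / m - (2 * s * l / p - m / p ^+ 2)
          = (s * l - m / p) ^+ 2 / m.
    by field; rewrite !lt0r_neq0.
  by rewrite mulr_ge0 ?sqr_ge0// invr_ge0.
have bias_ge : ((2 * s * (1 - l) / p - s ^+ 2 * invsq x / p ^+ 2)%:E
    <= ((1 - l) ^+ 2)%:E * x ^+ 2)%E.
  case: x x0 => [r||] //; last first.
    move=> _; rewrite invsqy mulr0 mul0r subr0.
    have [->|l1] := eqVneq l 1.
      by rewrite subrr mulr0 mul0r expr0n mul0e.
    rewrite [(+oo ^+ 2)%E]expe2 mulyy gt0_muley ?leey//.
    by rewrite lte_fin exprn_even_gt0//= subr_eq0 eq_sym.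
  rewrite lte_fin => r0; rewrite invsq_fin -EFin_expe -EFinM lee_fin -subr_ge0.
  have -> : (1 - l) ^+ 2 * r ^+ 2
            - (2 * s * (1 - l) / p - s ^+ 2 / r ^+ 2 / p ^+ 2)
          = ((1 - l) * r - s / (r * p)) ^+ 2.
    by field; rewrite !lt0r_neq0.
  exact: sqr_ge0.
apply: le_trans (leeD variance_ge bias_ge).
rewrite -EFinD lee_fin le_eqVlt; apply/orP; left; apply/eqP.
by field; rewrite lt0r_neq0.
Qed.

(** The a_i need not be square summable, so the vertex theta = a may lie outside
    ell2; its truncations do not, and they suffice to reach the supremum. *)
Lemma finite_support_ell2 (R : realType) (N : nat) (theta : nat -> R) :
  (forall i, (N <= i)%N -> theta i = 0) -> ell2 theta.
Proof.
move=> theta0; rewrite /ell2/= (nneseries_split 0 N); last first.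
  by move=> k _; rewrite lee_fin sqr_ge0.
rewrite eseries0; first by rewrite adde0 sumEFin ltry.
by move=> i; rewrite add0n => Ni _; rewrite theta0// expr0n.
Qed.

(** If every coordinate with a_i = +oo has l_i = 1, truncations of the vertex
    theta = a (with 0 in place of +oo) reach every partial sum of the series.
    Otherwise some unbounded coordinate carries a bias, and moving theta along
    it makes the risk arbitrarily large. *)
Lemma sum_worst_term_le (R : realType) (sigma m l : nat -> R)
    (a : nat -> \bar R) :
  (forall i, 0 <= m i) -> (forall i, (0 < a i)%E) ->
  (\sum_(i <oo) worst_term (sigma i) (m i) (l i) (a i)
    <= ereal_sup [set linear_risk sigma m l theta
                 | theta in hyperrectangle a])%E.
Proof.
move=> m0 a0.
have term_ge0 (theta : nat -> R) i :
    (0 <= (sigma i ^+ 2 * l i ^+ 2)%:E / (m i)%:E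
          + ((1 - l i) ^+ 2 * theta i ^+ 2)%:E)%E.
  by rewrite adde_ge0 ?variance_term_ge0// lee_fin mulr_ge0 ?sqr_ge0.
have [all1|/existsNP[j /not_implyP[aj lj]]] :=
    pselect (forall i, a i = +oo%E -> l i = 1).
  apply: lime_le.
    by apply: is_cvg_nneseries => i _ _; exact: worst_term_ge0.
  apply: nearW => N.
  pose theta i : R := if (i < N)%N then fine (a i) else 0.
  have theta_in : hyperrectangle a theta.
    split.
      by apply: (@finite_support_ell2 _ N) => i; rewrite /theta ltnNge => ->.
    move=> i; rewrite /theta; case: ifP => _; last by rewrite normr0 ltW.
    have := a0 i; case: (a i) => [r||] // r0; last by rewrite leey.
    by rewrite /= ger0_norm// ltW.
  apply: le_trans (ereal_sup_ubound _); last by exists theta.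
  apply: le_trans (nneseries_lim_ge N _); last by move=> i _ _; exact: term_ge0.
  rewrite big_nat_cond [leRHS]big_nat_cond.
  apply: lee_sum => i /andP[/andP[_ iN] _]; rewrite /worst_term /theta iN.
  apply: leeD => //; case: (a i) (a0 i) (all1 i) => [r||] //.
  by move=> _ /(_ erefl) ->; rewrite subrr expr0n mul0e mul0r.
suff -> : ereal_sup [set linear_risk sigma m l theta
                    | theta in hyperrectangle a] = +oo%E by rewrite leey.
apply/eqyP => A A0.
(* This value makes the squared bias of coordinate j equal to (A + 1)^2. *)
pose K := (A + 1) / `|1 - l j|.
have l1 : 0 < `|1 - l j| by rewrite normr_gt0 subr_eq0 eq_sym; apply/eqP.
pose theta i : R := if i == j then K else 0.
apply: le_trans (ereal_sup_ubound _); last first.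
  exists theta; last reflexivity.
  split.
    apply: (@finite_support_ell2 _ j.+1) => i; rewrite /theta.
    by case: eqP => // ->; rewrite ltnn.
  move=> i; rewrite /theta; case: eqP => [->|_]; first by rewrite aj leey.
  by rewrite normr0 ltW.
apply: le_trans (nneseries_lim_ge j.+1 _); last first.
  by move=> i _ _; exact: term_ge0.
rewrite big_nat_recr//=.
rewrite lee_paddl//; first by apply: sume_ge0 => i _; exact: term_ge0.
rewrite lee_paddl ?variance_term_ge0// lee_fin /theta eqxx /K.
rewrite exprMn exprVn -normrX (ger0_norm (sqr_ge0 _)) mulrCA divff; last first.
  by rewrite sqrf_eq0 -normr_gt0.
by rewrite mulr1; nra.
Qed.

(** * The water level *)

Definition level {R : realType} (sigma : nat -> R) (a : nat -> \bar R)
  (i : nat) : R := sigma i * invsq (a i).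

Definition water_level {R : realType} (sigma : nat -> R) (a : nat -> \bar R)
    (n : R) (d : nat) : R :=
  (n + \sum_(k < d) sigma k ^+ 2 * invsq (a k)) / \sum_(k < d) sigma k.

Lemma level_ge0 (R : realType) (sigma : nat -> R) (a : nat -> \bar R) i :
  0 < sigma i -> (0 < a i)%E -> 0 <= level sigma a i.
Proof. by move=> s0 a0; rewrite mulr_ge0 ?invsq_ge0// ltW. Qed.

Lemma level_ndecr (R : realType) (sigma : nat -> R) (a : nat -> \bar R) :
  (forall i, 0 < sigma i) -> (forall i, (0 < a i)%E) ->
  nondecreasing_seq sigma -> nonincreasing_seq a ->
  nondecreasing_seq (level sigma a).
Proof.
move=> s0 a0 sigma_ndecr a_nincr i j ij.
by rewrite ler_pM ?invsq_ge0 ?(ltW (s0 _)) ?sigma_ndecr ?invsq_nincr ?a_nincr.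
Qed.

Lemma sum_deficit (R : realType) (sigma : nat -> R) (a : nat -> \bar R)
    (h : R) (k : nat) :
  \sum_(i < k) sigma i * (h - sigma i * invsq (a i))
  = h * (\sum_(i < k) sigma i) - \sum_(i < k) sigma i ^+ 2 * invsq (a i).
Proof.
rewrite mulr_sumr -sumrB; apply: eq_bigr => i _.
by rewrite mulrBr expr2 mulrA [sigma i * h]mulrC.
Qed.

(** The summand of index 0 alone exceeds the budget for large k, because the
    levels tend to infinity. *)
Lemma active_counts_max (R : realType) (n : R) (sigma : nat -> R)
    (sigma_lb : R) (a : nat -> \bar R) :
  0 < n -> nondecreasing_seq sigma -> 0 < sigma_lb ->
  (forall i, sigma_lb <= sigma i) -> (forall i, (0 < a i)%E) ->
  nonincreasing_seq a -> a @ \oo --> 0%E ->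
  exists d, is_max (active_counts sigma a n) d.
Proof.
move=> n0 sigma_ndecr lb0 sigma_ge a0 a_nincr a_cvg0.
have s0 i : 0 < sigma i by exact: lt_le_trans (sigma_ge i).
have [k0 k0P] :=
  invsq_cvgy ((n / sigma 0%N + level sigma a 0) / sigma_lb) a0 a_cvg0.
have active1 : active_counts sigma a n 1.
  by split=> //; rewrite big_ord1 /= subrr mulr0 ltW.
have active_le k : active_counts sigma a n k -> (k <= k0)%N.
  case: k => [|k] //= -[_]; rewrite leNgt; apply: contraNltn => /k0P vk.
  have level_gt : n / sigma 0%N + level sigma a 0 < level sigma a k.
    rewrite /level [ltRHS]mulrC.
    apply: (@lt_le_trans _ _ (invsq (a k) * sigma_lb)).
      by rewrite -ltr_pdivrMr.
    by rewrite ler_wpM2l// invsq_ge0.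
  rewrite big_ord_recl /= -[ltLHS]addr0 ltr_leD//.
    by rewrite -ltr_pdivrMl// mulrC ltrBrDr.
  apply: sumr_ge0 => i _; rewrite mulr_ge0 ?(ltW (s0 _))// subr_ge0.
  by apply: (level_ndecr s0 a0 sigma_ndecr a_nincr); rewrite /bump/= add1n.
have exP : exists k, `[< active_counts sigma a n k >].
  by exists 1%N; apply/asboolP.
have leP k : `[< active_counts sigma a n k >] -> (k <= k0)%N.
  by move/asboolP; exact: active_le.
case: (ex_maxnP exP leP) => d /asboolP dA dmax.
by exists d; split=> // k kA; apply: dmax; apply/asboolP.
Qed.

Lemma sum_sigma_gt0 (R : realType) (sigma : nat -> R) (d : nat) :
  (forall i, 0 < sigma i) -> (0 < d)%N -> 0 < \sum_(k < d) sigma k.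
Proof.
case: d => // d s0 _; rewrite big_ord_recl ltr_pwDl//.
by apply: sumr_ge0 => i _; exact: ltW.
Qed.

Lemma water_level_gt0 (R : realType) (sigma : nat -> R) (a : nat -> \bar R)
    (n : R) (d : nat) :
  (forall i, 0 < sigma i) -> (forall i, (0 < a i)%E) -> 0 < n -> (0 < d)%N ->
  0 < water_level sigma a n d.
Proof.
move=> s0 a0 n0 d0; rewrite divr_gt0 ?sum_sigma_gt0//.
by rewrite ltr_pwDl// sumr_ge0// => i _; rewrite mulr_ge0 ?sqr_ge0 ?invsq_ge0.
Qed.

Lemma level_le_water_level (R : realType) (sigma : nat -> R)
    (a : nat -> \bar R) (n : R) (d i : nat) :
  (forall i, 0 < sigma i) -> (forall i, (0 < a i)%E) ->
  nondecreasing_seq sigma -> nonincreasing_seq a ->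
  active_counts sigma a n d -> (i < d)%N ->
  level sigma a i <= water_level sigma a n d.
Proof.
move=> s0 a0 sigma_ndecr a_nincr [d0 + id]; rewrite sum_deficit lerBlDr => act.
apply: le_trans (_ : level sigma a d.-1 <= _).
  by apply: level_ndecr => //; rewrite -ltnS prednK.
by rewrite ler_pdivlMr ?sum_sigma_gt0.
Qed.

(** In the condition for d + 1 coordinates the last summand is zero, so its
    failure is exactly the inequality for the level of the coordinate d. *)
Lemma water_level_lt_level (R : realType) (sigma : nat -> R)
    (a : nat -> \bar R) (n : R) (d i : nat) :
  (forall i, 0 < sigma i) -> (forall i, (0 < a i)%E) ->
  nondecreasing_seq sigma -> nonincreasing_seq a ->
  is_max (active_counts sigma a n) d -> (d <= i)%N ->
  water_level sigma a n d < level sigma a i.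
Proof.
move=> s0 a0 sigma_ndecr a_nincr [[d0 _] dmax] di.
apply: lt_le_trans (_ : level sigma a d <= _); last exact: level_ndecr.
rewrite ltr_pdivrMr ?sum_sigma_gt0// -ltrBrDr ltNge; apply/negP => act.
suff /dmax : active_counts sigma a n d.+1 by rewrite ltnn.
by split=> //=; rewrite big_ord_recr /= subrr mulr0 addr0 sum_deficit.
Qed.

(** * The water-filling allocation *)

Lemma opt_alloc_active (R : realType) (sigma : nat -> R) (a : nat -> \bar R)
    (n : R) (d i : nat) : (i < d)%N ->
  opt_alloc sigma a n d i
  = sigma i * (water_level sigma a n d - level sigma a i).
Proof.
by move=> id; rewrite /opt_alloc id mulrBr mulrA /water_level mulrA.
Qed.

Lemma opt_alloc_inactive (R : realType) (sigma : nat -> R)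
    (a : nat -> \bar R) (n : R) (d i : nat) : (d <= i)%N ->
  opt_alloc sigma a n d i = 0.
Proof. by rewrite /opt_alloc ltnNge => ->. Qed.

Lemma opt_alloc_ge0 (R : realType) (sigma : nat -> R) (a : nat -> \bar R)
    (n : R) (d i : nat) :
  (forall i, 0 < sigma i) -> (forall i, (0 < a i)%E) ->
  nondecreasing_seq sigma -> nonincreasing_seq a ->
  active_counts sigma a n d -> 0 <= opt_alloc sigma a n d i.
Proof.
move=> s0 a0 sigma_ndecr a_nincr act.
have [id|di] := ltnP i d; last by rewrite opt_alloc_inactive.
rewrite opt_alloc_active// mulr_ge0 ?(ltW (s0 _))// subr_ge0.
exact: level_le_water_level.
Qed.

Lemma opt_alloc_total (R : realType) (sigma : nat -> R) (a : nat -> \bar R)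
    (n : R) (d : nat) :
  (forall i, 0 < sigma i) -> (0 < d)%N ->
  (forall i, 0 <= opt_alloc sigma a n d i) ->
  (\sum_(i <oo) (opt_alloc sigma a n d i)%:E = n%:E)%E.
Proof.
move=> s0 d0 alloc_ge0.
rewrite (nneseries_split 0 d); last by move=> k _; rewrite lee_fin.
rewrite eseries0; last by move=> i di _; rewrite opt_alloc_inactive.
rewrite adde0 add0n sumEFin big_mkord; congr EFin.
under eq_bigr => i _ do rewrite opt_alloc_active//.
rewrite sum_deficit divfK ?addrK//.
by rewrite lt0r_neq0// sum_sigma_gt0.
Qed.

(** * The optimal risk *)

(** The risk that coordinate i contributes at the optimum: s^2 / (m + s^2 a^-2)
    with m = s (c - w) below the water level, and a^2 without measurements. *)
Definition opt_term {R : realType} (sigma : nat -> R) (a : nat -> \bar R)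
    (n : R) (d i : nat) : \bar R :=
  if (i < d)%N then (sigma i / water_level sigma a n d)%:E else (a i ^+ 2)%E.

Lemma opt_term_ge0 (R : realType) (sigma : nat -> R) (a : nat -> \bar R)
    (n : R) (d i : nat) :
  (forall i, 0 < sigma i) -> (forall i, (0 < a i)%E) -> 0 < n ->
  (0 < d)%N -> (0 <= opt_term sigma a n d i)%E.
Proof.
move=> s0 a0 n0 d0; rewrite /opt_term; case: ifP => _; last first.
  by rewrite expe_ge0// ltW.
by rewrite lee_fin divr_ge0 ?ltW ?water_level_gt0.
Qed.

Lemma sum_opt_term (R : realType) (sigma : nat -> R) (a : nat -> \bar R)
    (n : R) (d : nat) :
  (forall i, 0 < sigma i) -> (forall i, (0 < a i)%E) -> 0 < n ->
  (0 < d)%N ->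
  (\sum_(i <oo) opt_term sigma a n d i
   = ((\sum_(i < d) sigma i) ^+ 2
         / (n + \sum_(i < d) sigma i ^+ 2 * invsq (a i)))%:E
     + \sum_(d <= i <oo) (a i ^+ 2))%E.
Proof.
move=> s0 a0 n0 d0.
rewrite (nneseries_split 0 d); last by move=> k _; exact: opt_term_ge0.
rewrite add0n big_mkord; congr (_ + _)%E.
  under eq_bigr => i _ do rewrite /opt_term ltn_ord.
  by rewrite sumEFin -mulr_suml /water_level invfM invrK mulrCA mulrC -expr2.
apply/congr_lim/funext => k; apply: eq_big_nat => i /andP[di _].
by rewrite /opt_term ltnNge di.
Qed.

(** The optimal term minimizes the risk of a coordinate plus the cost of its
    measurements at price 1 / c^2.  Above the water level the slope
    - 1 / w^2 of the tangent at m = 0 is less steep than the price, so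
    buying no measurement is best. *)
Lemma opt_term_le (R : realType) (sigma : nat -> R) (a : nat -> \bar R)
    (n m l : R) (d i : nat) :
  (forall i, 0 < sigma i) -> (forall i, (0 < a i)%E) -> 0 < n ->
  nondecreasing_seq sigma -> nonincreasing_seq a ->
  is_max (active_counts sigma a n) d -> 0 <= m ->
  (opt_term sigma a n d i
     + ((water_level sigma a n d)^-1 ^+ 2 * opt_alloc sigma a n d i)%:E
   <= worst_term (sigma i) m l (a i)
     + ((water_level sigma a n d)^-1 ^+ 2 * m)%:E)%E.
Proof.
move=> s0 a0 n0 sigma_ndecr a_nincr dmax m0.
have d0 : (0 < d)%N by case: dmax => -[].
have := water_level_gt0 s0 a0 n0 d0.
set c := water_level sigma a n d => c0.
have [id|di] := ltnP i d.
  rewrite opt_alloc_active// /opt_term id -EFinD -leeBlDr// -EFinB.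
  apply: le_trans (worst_term_ge l (s0 i) m0 c0 (a0 i)); rewrite lee_fin.
  rewrite -/c /level le_eqVlt; apply/orP; left; apply/eqP.
  by field; rewrite lt0r_neq0.
rewrite opt_alloc_inactive// mulr0 adde0 /opt_term [(i < d)%N]ltnNge di.
have lc : c < level sigma a i by exact: water_level_lt_level.
have l0 : 0 < level sigma a i by exact: lt_trans lc.
have v0 : 0 < invsq (a i) by rewrite -(pmulr_rgt0 _ (s0 i)).
(* The tangent at m = 0 is the bound with p equal to the level. *)
rewrite sqr_gt0_invsq// -leeBlDr// -EFinB.
apply: le_trans (worst_term_ge l (s0 i) m0 l0 (a0 i)); rewrite lee_fin.
have -> : 2 * sigma i / level sigma a i
    - sigma i ^+ 2 * invsq (a i) / level sigma a i ^+ 2 = (invsq (a i))^-1.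
  by rewrite /level; field; rewrite !lt0r_neq0.
rewrite lerB// mulrC ler_wpM2r// -exprVn lerXn2r ?nnegrE ?invr_ge0 ?ltW//.
by rewrite ltf_pV2 ?posrE.
Qed.

(** Summing [opt_term_le]: the optimal allocation spends the whole budget n and
    m spends at most n, so the costs can be cancelled. *)
Lemma minimax_risk_ge (R : realType) (sigma m : nat -> R) (a : nat -> \bar R)
    (n : R) (d : nat) :
  (forall i, 0 < sigma i) -> (forall i, (0 < a i)%E) -> 0 < n ->
  nondecreasing_seq sigma -> nonincreasing_seq a ->
  is_max (active_counts sigma a n) d -> allocations n m ->
  (\sum_(i <oo) opt_term sigma a n d i
    <= minimax_linear_risk sigma m (hyperrectangle a))%E.
Proof.
move=> s0 a0 n0 sigma_ndecr a_nincr dmax [m0 mn].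
have d0 : (0 < d)%N by case: dmax => -[].
apply/ereal_infP => _ [l _ <-].
apply: le_trans (sum_worst_term_le sigma l m0 a0).
have alloc_ge0 i : 0 <= opt_alloc sigma a n d i.
  by apply: opt_alloc_ge0 => //; case: dmax.
pose q := (water_level sigma a n d)^-1 ^+ 2.
have q0 : 0 <= q by rewrite sqr_ge0.
have priced : (\sum_(i <oo) opt_term sigma a n d i + (q * n)%:E
    <= \sum_(i <oo) worst_term (sigma i) (m i) (l i) (a i)
       + q%:E * \sum_(i <oo) (m i)%:E)%E.
  rewrite (EFinM q n) -(opt_alloc_total s0 d0 alloc_ge0).
  rewrite -!nneseriesZl; try by move=> i _; rewrite lee_fin.
  rewrite -!nneseriesD; try by move=> i _ _;
    rewrite ?opt_term_ge0 ?worst_term_ge0 // mule_ge0// lee_fin.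
  apply: lee_nneseries => [i _ _|i _].
    by rewrite adde_ge0 ?opt_term_ge0// mule_ge0// lee_fin.
  by rewrite -!EFinM; exact: opt_term_le.
rewrite -(@leeD2rE _ (q * n)%:E)//.
apply: le_trans priced _; rewrite leeD2l// (EFinM q n).
by rewrite lee_wpmul2l// lee_fin.
Qed.

(** The witnessing weights make the squares behind [worst_term_ge] vanish,
    at p = c below the water level and at p = w above it. *)
Lemma minimax_risk_opt_alloc_le (R : realType) (sigma : nat -> R)
    (a : nat -> \bar R) (n : R) (d : nat) :
  (forall i, 0 < sigma i) -> (forall i, (0 < a i)%E) -> 0 < n ->
  nondecreasing_seq sigma -> nonincreasing_seq a ->
  active_counts sigma a n d ->
  (minimax_linear_risk sigma (opt_alloc sigma a n d) (hyperrectangle a)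
    <= \sum_(i <oo) opt_term sigma a n d i)%E.
Proof.
move=> s0 a0 n0 sigma_ndecr a_nincr act.
have d0 : (0 < d)%N by case: act.
have := water_level_gt0 s0 a0 n0 d0.
set c := water_level sigma a n d => c0.
pose l i := if (i < d)%N then 1 - level sigma a i / c else 0.
apply: le_trans (ereal_inf_lbound _) _; first by exists l.
apply/ereal_supP => _ [theta [_ theta_le] <-].
have alloc_ge0 i : 0 <= opt_alloc sigma a n d i by exact: opt_alloc_ge0.
apply: lee_nneseries => [i _ _|i _].
  by rewrite adde_ge0 ?variance_term_ge0// lee_fin mulr_ge0 ?sqr_ge0.
have sqr_le : ((theta i ^+ 2)%:E <= a i ^+ 2)%E.
  have := theta_le i; have := a0 i; case: (a i) => [r||] //.
    rewrite lte_fin lee_fin => r0 tr; rewrite -EFin_expe lee_fin.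
    by rewrite -[leLHS]real_normK ?num_real// lerXn2r ?nnegrE// ltW.
  by move=> _ _; rewrite [(+oo ^+ 2)%E]expe2 mulyy leey.
rewrite /l /opt_term; have [id|di] := ltnP i d; last first.
  by rewrite expr0n mulr0 mul0e add0e subr0 expr1n mul1r.
rewrite opt_alloc_active// -/c.
set w := level sigma a i.
have wc : w <= c by exact: level_le_water_level.
(* When w = c the coordinate gets no measurement, but its weight is 0 as well
   and the variance is 0 / 0 = 0. *)
have variance_eq : (((sigma i ^+ 2 * (1 - w / c) ^+ 2)%:E
    / (sigma i * (c - w))%:E) = (sigma i * (c - w) / c ^+ 2)%:E)%E.
  have [->|wc'] := eqVneq w c.
    by rewrite divff ?lt0r_neq0// !subrr expr0n/= !(mulr0, mul0r, mul0e).
  rewrite inver mulf_eq0 subr_eq0 [c == w]eq_sym (negbTE wc') orbF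
    gt_eqF//.
  rewrite -EFinM; congr EFin; field.
  by rewrite !lt0r_neq0//= subr_gt0 lt_neqAle wc'.
have bias_le : w ^+ 2 * theta i ^+ 2 <= sigma i * w.
  have [->|w_neq0] := eqVneq w 0; first by rewrite expr0n mul0r mulr0.
  have v0 : 0 < invsq (a i).
    rewrite lt0r invsq_ge0// andbT; apply: contra_neq w_neq0.
    by rewrite /w /level => ->; rewrite mulr0.
  move: sqr_le; rewrite sqr_gt0_invsq// lee_fin => sqr_le.
  have -> : sigma i * w = w ^+ 2 * (invsq (a i))^-1.
    by rewrite /w /level; field; rewrite lt0r_neq0.
  by rewrite ler_wpM2l ?sqr_ge0.
rewrite variance_eq -EFinD lee_fin opprB [1 + _]addrC addrNK.
rewrite -subr_ge0.
have -> : sigma i / c - (sigma i * (c - w) / c ^+ 2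
            + (w / c) ^+ 2 * theta i ^+ 2)
    = (sigma i * w - w ^+ 2 * theta i ^+ 2) / c ^+ 2.
  by field; rewrite lt0r_neq0.
by rewrite divr_ge0 ?sqr_ge0// subr_ge0.
Qed.

(** * Optimality of water-filling *)

Theorem theorem2 (R : realType) (n : R) (sigma : nat -> R) (sigma_lb : R)
    (a : nat -> \bar R)
    (n_gt0 : 0 < n)
    (sigma_ndecr : nondecreasing_seq sigma)
    (sigma_lb_gt0 : 0 < sigma_lb)
    (sigma_ge : forall i, sigma_lb <= sigma i)
    (a_gt0 : forall i, (0 < a i)%E)
    (a_nincr : nonincreasing_seq a)
    (a_cvg0 : a @ \oo --> 0%E) :
  exists d : nat,
    is_max (active_counts sigma a n) d /\
    allocations n (opt_alloc sigma a n d) /\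
    minimax_linear_risk sigma (opt_alloc sigma a n d) (hyperrectangle a)
      = ereal_inf [set minimax_linear_risk sigma m (hyperrectangle a)
                  | m in allocations n] /\
    minimax_linear_risk sigma (opt_alloc sigma a n d) (hyperrectangle a)
      = (((\sum_(i < d) sigma i) ^+ 2
            / (n + \sum_(i < d) sigma i ^+ 2 * invsq (a i)))%:E
         + \sum_(d <= i <oo) (a i ^+ 2))%E.
Proof.
have s0 i : 0 < sigma i by exact: lt_le_trans (sigma_ge i).
have [d dmax] := active_counts_max n_gt0 sigma_ndecr sigma_lb_gt0 sigma_ge
  a_gt0 a_nincr a_cvg0.
have act := dmax.1; have d0 := act.1.
have alloc_ge0 i := opt_alloc_ge0 i s0 a_gt0 sigma_ndecr a_nincr act.
have alloc_in : allocations n (opt_alloc sigma a n d).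
  by split=> //; rewrite opt_alloc_total.
have risk_ge m (m_in : allocations n m) :=
  minimax_risk_ge s0 a_gt0 n_gt0 sigma_ndecr a_nincr dmax m_in.
have opt_le := minimax_risk_opt_alloc_le s0 a_gt0 n_gt0 sigma_ndecr a_nincr act.
exists d; split=> //; split=> //; split.
  apply/eqP; rewrite eq_le; apply/andP; split; last first.
    by apply: ereal_inf_lbound; exists (opt_alloc sigma a n d).
  by apply/ereal_infP => _ [m m_in <-]; apply: le_trans opt_le (risk_ge _ m_in).
rewrite -sum_opt_term//; apply/eqP; rewrite eq_le opt_le/=.
exact: risk_ge.
Qed.
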